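(* Let $k$ be an algebraically closed field and let $E$ be a (finite) staircase. The tangent space $T_{Z(E)}$ to the Hilbert scheme $\mathbb{H}$ at $Z(E)$ is isomorphic to the $k$-vector space $R$ having as basis the set of significant cleft couples of $E$.
   Context: $\mathbb{H}$ is the Hilbert scheme of zero-dimensional subschemes of $\mathrm{Spec}\,k[x,y]$. Monomials $x^py^q$ are identified with pairs $(p,q)\in\mathbb{N}^2$. A staircase is a finite subset $E\subset\mathbb{N}^2$ whose complement is stable under addition of $\mathbb{N}^2$; $I^E$ is the monomial ideal spanned by the monomials not in $E$, and $Z(E)$ is the subscheme with ideal $I^E$. A cleft of $E$ is a monomial of $I^E$ minimal for divisibility among the monomials of $I^E$. A positive (resp. negative) half-direction is a pair of relatively prime integers $(f,g)$ with $f>0$ (resp. $f<0$), or $f=0$ and $g<0$ (resp. $g>0$). A cleft couple is a pair $(c,m)$ with $c$ a cleft and $m\in E$; it has half-direction $(f,g)$ if the vector from $c$ to $m$ is a positive multiple of $(f,g)$. Let $>_+$ be the lexicographic order on the pairs $(p,q)$, and $>_-$ the lexicographic order on the pairs $(q,p)$, for monomials $x^py^q$. A cleft couple $(c,m)$ with positive (resp. negative) half-direction is significant if, $c'$ being the successor of $c$ among the clefts for $>_+$ (resp. $>_-$) and $s$ the least common multiple of $c$ and $c'$, one has $m\frac{s}{c}\notin E$. *)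

(* Defs.v *)
From HB Require Import structures.
From mathcomp Require Import all_boot all_order all_algebra.
From mathcomp Require Import finmap.
From mathcomp Require Import boolp classical_sets.
From mathcomp Require Import freeg mpoly.

Set Implicit Arguments.
Unset Strict Implicit.
Unset Printing Implicit Defensive.

Import GRing.Theory.
Local Open Scope ring_scope.

(* [(a, v)] stands for [a + v_1 e_1 + ... + v_n e_n]; in particular
   [dual k 1] is the ring of dual numbers. *)
Definition dual (k : fieldType) (n : nat) : Type := (k * 'rV[k]_n)%type.

Section DualRing.
Variables (k : fieldType) (n : nat).

HB.instance Definition _ := GRing.Zmodule.on (dual k n).

Definition dual_one : dual k n := (1, 0).
Definition dual_mul (u v : dual k n) : dual k n :=
  (u.1 * v.1, u.1 *: v.2 + v.1 *: u.2).

Fact dual_mulA : associative dual_mul.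
Proof.
move=> [a u] [b v] [c w]; rewrite /dual_mul /=; congr pair; first exact: mulrA.
by rewrite !scalerDr !scalerA addrA (mulrC c a) (mulrC c b).
Qed.

Fact dual_mulC : commutative dual_mul.
Proof. by move=> [a u] [b v]; rewrite /dual_mul /= mulrC addrC. Qed.

Fact dual_mul1 : left_id dual_one dual_mul.
Proof. by move=> [a u]; rewrite /dual_mul /= mul1r scale1r scaler0 addr0. Qed.

Fact dual_mulDl : left_distributive dual_mul +%R.
Proof.
move=> [a u] [b v] [c w]; rewrite /dual_mul /=; congr pair; first exact: mulrDl.
by rewrite scalerDl scalerDr addrACA.
Qed.

Fact dual_oner_neq0 : dual_one != 0.
Proof. by apply/eqP => -[/eqP]; rewrite oner_eq0. Qed.

HB.instance Definition _ := GRing.Zmodule_isComNzRing.Build (dual k n)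
  dual_mulA dual_mulC dual_mul1 dual_mulDl dual_oner_neq0.

Definition dual_aug (u : dual k n) : k := u.1.

Fact dual_aug_is_zmod_morphism : zmod_morphism dual_aug.
Proof. by []. Qed.
Fact dual_aug_is_monoid_morphism : monoid_morphism dual_aug.
Proof. by []. Qed.

HB.instance Definition _ :=
  GRing.isZmodMorphism.Build (dual k n) k dual_aug dual_aug_is_zmod_morphism.
HB.instance Definition _ :=
  GRing.isMonoidMorphism.Build (dual k n) k dual_aug dual_aug_is_monoid_morphism.

End DualRing.

Section DualMap.
Variables (k : fieldType) (m n : nat) (M : 'M[k]_(m, n)).

(* The morphism of k-algebras sending [e_i] to [\sum_j M i j e_j]. *)
Definition dual_map (u : dual k m) : dual k n := (u.1, u.2 *m M).

Fact dual_map_is_zmod_morphism : zmod_morphism dual_map.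
Proof. by move=> [a u] [b v]; rewrite /dual_map /= mulmxBl. Qed.
Fact dual_map_is_monoid_morphism : monoid_morphism dual_map.
Proof.
split=> [|[a u] [b v]]; rewrite /dual_map /=; first by rewrite mul0mx.
by rewrite mulmxDl -!scalemxAl.
Qed.

HB.instance Definition _ := GRing.isZmodMorphism.Build (dual k m) (dual k n)
  dual_map dual_map_is_zmod_morphism.
HB.instance Definition _ := GRing.isMonoidMorphism.Build (dual k m) (dual k n)
  dual_map dual_map_is_monoid_morphism.

End DualMap.

Section Hilbert.

Definition ideal (A : comNzRingType) (J : set {mpoly A[2]}) : Prop :=
  [/\ J 0, forall f g, J f -> J g -> J (f + g) &
      forall f g : {mpoly A[2]}, J g -> J (f * g)].

Definition gen_ideal (A : comNzRingType) (X : set {mpoly A[2]}) :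
    set {mpoly A[2]} :=
  [set f | forall J, ideal J -> (X `<=` J)%classic -> J f].

(* [J] is an A-point of the Hilbert scheme: a closed subscheme of the affine
   plane over A which is finite and locally free over Spec A.  This form is for
   a local ring A, over which locally free of finite rank means free of finite
   rank: [A[x,y]/J] has a finite A-basis, given by the classes of the [b i].
   It is used below for [A = dual k n] only. *)
Definition hilb (A : comNzRingType) (J : set {mpoly A[2]}) : Prop :=
  ideal J /\
  exists (n : nat) (b : 'I_n -> {mpoly A[2]}),
    forall f : {mpoly A[2]}, exists! a : {ffun 'I_n -> A}, J (f - \sum_i a i *: b i).

(* Base change of a closed subscheme along Spec B -> Spec A. *)
Definition base_change (A B : comNzRingType) (h : {rmorphism A -> B})
    (J : set {mpoly A[2]}) : set {mpoly B[2]} :=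
  gen_ideal [set map_mpoly h f | f in J]%classic.

(* The tangent space at the k-point [I]: the k[e]-points of the Hilbert scheme
   which restrict to [I] at the closed point. *)
Definition tangent (k : fieldType) (I : set {mpoly k[2]}) : Type :=
  {J : set {mpoly (dual k 1)[2]} |
     hilb J /\ base_change (@dual_aug k 1) J = I}.

(* The vector space structure of the tangent space, as for any functor of
   points: [J1 + J2 = J] when some k[e_1, e_2]-point restricts to [J1] along
   (e_1, e_2) |-> (e, 0), to [J2] along (e_1, e_2) |-> (0, e) and to [J] along
   (e_1, e_2) |-> (e, e); and [c J] is the base change of [J] along e |-> c e. *)
Definition tangent_add (k : fieldType) (I : set {mpoly k[2]})
    (J1 J2 J : tangent I) : Prop :=
  exists K : set {mpoly (dual k (1 + 1)%N)[2]},
    [/\ hilb K,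
        base_change (dual_map (col_mx 1%:M 0)) K = sval J1,
        base_change (dual_map (col_mx 0 1%:M)) K = sval J2 &
        base_change (dual_map (col_mx 1%:M 1%:M)) K = sval J].

Definition tangent_scale (k : fieldType) (I : set {mpoly k[2]}) (c : k)
    (J J' : tangent I) : Prop :=
  base_change (dual_map c%:M) (sval J) = sval J'.

(* As [phi] is bijective, the last two conditions say both that the relations
   above are the graphs of vector space operations on [tangent I] and that
   [phi] is linear for them. *)
Definition tangent_iso (k : fieldType) (I : set {mpoly k[2]}) (V : lmodType k)
    (phi : tangent I -> V) : Prop :=
  [/\ bijective phi,
      forall J1 J2 J, tangent_add J1 J2 J <-> phi J1 + phi J2 = phi J &
      forall c J J', tangent_scale c J J' <-> c *: phi J = phi J'].

End Hilbert.

Section Staircase.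
Local Open Scope fset_scope.

(* The monomial x^p y^q is [m] with [expx m = p] and [expy m = q]. *)
Definition expx (m : 'X_{1..2}) : nat := m ord0.
Definition expy (m : 'X_{1..2}) : nat := m ord_max.

Definition staircase (E : {fset 'X_{1..2}}) : Prop :=
  forall m n : 'X_{1..2}, m \notin E -> (m + n)%MM \notin E.

Definition monomial_ideal (k : fieldType) (E : {fset 'X_{1..2}}) :
    set {mpoly k[2]} :=
  [set f | {in msupp f, forall m, m \notin E}].

Definition cleft (E : {fset 'X_{1..2}}) (c : 'X_{1..2}) : Prop :=
  c \notin E /\ forall m : 'X_{1..2}, m \notin E -> (m <= c)%MM -> m = c.

Definition positive_half_direction (d : int * int) : Prop :=
  coprimez d.1 d.2 /\ (0 < d.1 \/ d.1 = 0 /\ d.2 < 0).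

Definition negative_half_direction (d : int * int) : Prop :=
  coprimez d.1 d.2 /\ (d.1 < 0 \/ d.1 = 0 /\ 0 < d.2).

Definition cleft_couple (E : {fset 'X_{1..2}})
    (cm : 'X_{1..2} * 'X_{1..2}) : Prop :=
  cleft E cm.1 /\ cm.2 \in E.

Definition has_half_direction (cm : 'X_{1..2} * 'X_{1..2})
    (d : int * int) : Prop :=
  exists2 t : int, 0 < t &
    (expx cm.2)%:Z - (expx cm.1)%:Z = t * d.1 /\
    (expy cm.2)%:Z - (expy cm.1)%:Z = t * d.2.

Definition gt_pos (m n : 'X_{1..2}) : Prop :=
  (expx n < expx m)%N \/ expx m = expx n /\ (expy n < expy m)%N.

Definition gt_neg (m n : 'X_{1..2}) : Prop :=
  (expy n < expy m)%N \/ expy m = expy n /\ (expx n < expx m)%N.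

Definition successor (gt : 'X_{1..2} -> 'X_{1..2} -> Prop)
    (E : {fset 'X_{1..2}}) (c c' : 'X_{1..2}) : Prop :=
  [/\ cleft E c', gt c' c &
      forall c'', cleft E c'' -> gt c'' c -> c'' = c' \/ gt c'' c'].

(* [m + (mlcm c c' - c)] is the exponent of m s / c, where s = lcm(c, c'); the
   truncated subtraction is exact since c divides s. *)
Definition significant_for (gt : 'X_{1..2} -> 'X_{1..2} -> Prop)
    (E : {fset 'X_{1..2}}) (cm : 'X_{1..2} * 'X_{1..2}) : Prop :=
  exists2 c', successor gt E cm.1 c' &
    (cm.2 + (mlcm cm.1 c' - cm.1))%MM \notin E.

Definition significant (E : {fset 'X_{1..2}})
    (cm : 'X_{1..2} * 'X_{1..2}) : Prop :=
  cleft_couple E cm /\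
  exists2 d, has_half_direction cm d &
    (positive_half_direction d /\ significant_for gt_pos E cm) \/
    (negative_half_direction d /\ significant_for gt_neg E cm).

Definition significant_couple (E : {fset 'X_{1..2}}) : Type :=
  {cm : 'X_{1..2} * 'X_{1..2} | `[< significant E cm >]}.
HB.instance Definition _ (E : {fset 'X_{1..2}}) :=
  Choice.on (significant_couple E).

Definition significant_space (k : fieldType) (E : {fset 'X_{1..2}}) :
    lmodType k :=
  {freeg (significant_couple E) / k}.

End Staircase.

Arguments monomial_ideal k E : clear implicits.

(* Main.v *)
From HB Require Import structures.
Require Import Defs.
From mathcomp Require Import all_boot all_order all_algebra.
From mathcomp Require Import finmap zify.
From mathcomp Require Import boolp classical_sets.
From mathcomp Require Import freeg mpoly.

(** Let I be the monomial ideal of E and A = k[x, y]. The monomials of E form a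
    basis of A / I, and a deformation J of I over the dual numbers (or over
    k[e_1, e_2]) has a quotient which is free on the same monomials: they span it
    by Nakayama's lemma, the maximal ideal having square 0 ([spanned_all]), and
    they are independent because the quotient is free ([independent_all]). So J
    is given by the normal forms x^u = eps (sum of a(u, m) x^m), for u outside of
    E and m in E. The condition that J is an ideal is linear in a: it says that a
    is the coefficient array of an A-linear map from I to A / I ([hom_coefs],
    [tangent_consts_structure], [hilb_tangent_consts]). As base change transforms
    the structure constants in the obvious way ([base_change_nf_kernel]), the
    vector space operations on tangent vectors are those on the arrays a
    ([tangent_addP], [tangent_scaleP]).

    It remains to show that a is freely determined by its values at the
    significant couples ([hom_coefs_eq], [hom_coefs_ex]). Regard a as a function on
    arrows from u to m. Linearity says that a is constant when an arrow is
    translated with its source staying outside of E and its target inside E, and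
    that a is 0 if the target can be pushed out of the quadrant. An arrow pointing
    downwards with source in row y is normalized as follows. If after a horizontal
    move it can be lowered by one row, it is lowered. If it cannot be lowered, it
    is moved left to the beginning of its row, where its source is a cleft; as
    it cannot be lowered there, it is a significant couple. Thus the
    value of a on the arrow is its value at a significant couple, or 0 if the walk
    leaves the quadrant ([row_vanish]); conversely the walk defines a
    translation invariant function with prescribed values at the significant
    couples ([row_walk], [row_extend]). The arrows not pointing downwards point to
    the left, and exchanging the two variables reduces them to this case. *)

Set Implicit Arguments.
Unset Strict Implicit.
Unset Printing Implicit Defensive.

Import Order.TTheory GRing.Theory Num.Theory.
Local Open Scope ring_scope.

(** * Translation invariant functions of arrows *)

Section Rows.
Variables (V : nmodType) (L : nat -> nat).
Hypothesis L_anti : forall y y', (y <= y')%N -> (L y' <= L y)%N.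

(** The numerical form of a significant couple with c = (x, y), m = (mx, my) and
    m to the lower right of c: the cleft c begins row y, and moving m
    horizontally by the width L y.-1 - L y of the step below c leads out of the
    staircase. *)
Definition row_couple (x y mx my : nat) : Prop :=
  [/\ (0 < y)%N, x = L y, (x <= mx)%N, (my < y)%N &
      (mx < L my <= mx + (L y.-1 - x))%N].

(** Functions of arrows: the arguments are the coordinates (ux, uy) of the
    source and (mx, my) of the target. *)
Definition arrow_fun := nat -> nat -> nat -> nat -> V.

(** The value on an arrow with source outside and target inside the staircase
    does not change when the arrow is translated one step to the right. An arrow
    with target on the left edge of the quadrant has the value 0 if its source
    can be moved one step to the left outside of the staircase. *)
Definition stable_right (a : arrow_fun) : Prop :=
  forall ux uy mx my, (L uy <= ux)%N -> (mx < L my)%N ->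
    a ux.+1 uy mx my = if mx is mx'.+1 then a ux uy mx' my else 0.

(** The same for translation one step up. *)
Definition stable_up (a : arrow_fun) : Prop :=
  forall ux uy mx my, (L uy <= ux)%N -> (mx < L my)%N ->
    a ux uy.+1 mx my = if my is my'.+1 then a ux uy mx my' else 0.

Lemma stable_right_shift a t ux uy mx my :
  stable_right a -> (L uy <= ux)%N -> (mx + t < L my)%N ->
  a (ux + t)%N uy (mx + t)%N my = a ux uy mx my.
Proof.
move=> sa; elim: t => [|t IH] hu hm; first by rewrite !addn0.
by rewrite !addnS sa ?IH //; lia.
Qed.

(** A translation invariant function vanishes on the arrows pointing downwards
    as soon as it does on the significant ones: an arrow either can be moved
    right, then down one row, or is a translate of a significant arrow. *)
Lemma row_vanish a : stable_right a -> stable_up a ->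
    (forall x y mx my, row_couple x y mx my -> a x y mx my = 0) ->
  forall ux uy mx my, (L uy <= ux)%N -> (mx < L my)%N -> (my < uy)%N ->
    a ux uy mx my = 0.
Proof.
move=> sR sU a0 ux uy; elim: uy ux => // y IH ux mx my hu hm hmy.
have hL := L_anti (leqnSn y); have hLm := @L_anti my y hmy.
(* An arrow whose source stays outside of the staircase when lowered by one row
   is lowered, and the induction hypothesis applies. *)
have step x m : (L y <= x)%N -> (m < L my)%N -> a x y.+1 m my = 0.
  move=> hx hm'; rewrite sU //; case: my hmy {hm} hm' hLm => // my' hmy hm' hLm.
  by apply: IH => //; have := @L_anti my' my'.+1 (leqnSn _); lia.
have [hx|hx] := leqP (L y) ux; first exact: step.
(* L y - ux is the least shift to the right after which the arrow can be
   lowered. *)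
have [hin|hout] := ltnP (mx + (L y - ux)) (L my).
  rewrite -(stable_right_shift (t := L y - ux) sR) //.
  by apply: step => //; lia.
(* Otherwise the arrow is a translate of a significant one with source at the
   beginning of the row. *)
have hux : (L y.+1 <= ux <= mx)%N by lia.
have -> : ux = (L y.+1 + (ux - L y.+1))%N by lia.
have -> : mx = (mx - (ux - L y.+1) + (ux - L y.+1))%N by lia.
rewrite stable_right_shift //; last by lia.
by apply: a0; split; rewrite //=; lia.
Qed.

(** The value on the arrows with source in row y and direction (f, - g): starting
    from the beginning of the row, the arrow is moved to the row below as long as
    this is possible; the arrow at which the walk stops has value given by b, and
    a walk leading out of the quadrant gives 0. *)
Fixpoint row_walk (b : arrow_fun) (f g y : nat) : V :=
  if y is y'.+1 then
    if (y < g)%N then 0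
    else if (L y' + f < L (y - g))%N then row_walk b f g y'
    else b (L y) y (L y + f)%N (y - g)%N
  else 0.

(** The translation invariant function of arrows that takes the values of b on
    the row couples and is 0 on the arrows pointing up or left. *)
Definition row_extend (b : arrow_fun) : arrow_fun := fun ux uy mx my =>
  if (ux <= mx)%N && (my < uy)%N then row_walk b (mx - ux) (uy - my) uy else 0.

Lemma row_walk0 b f g y : (y < g)%N -> row_walk b f g y = 0.
Proof. by case: y => //= y ->. Qed.

Lemma row_extend_right b : stable_right (row_extend b).
Proof.
by move=> ux uy [|mx] my hu hm; rewrite /row_extend ?ltnS ?subSS ?ltn0.
Qed.

Lemma row_extend_up b : stable_up (row_extend b).
Proof.
move=> ux uy mx my hu hm; rewrite /row_extend.
have [hx|hx] := leqP ux mx; last by case: my hm => [|my].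
case: my hm => [|my] hm.
  rewrite /= subn0 ltnn subnn ifT ?row_walk0 //; lia.
rewrite ltnS subSS /=; case: ltnP => // hy.
rewrite ifF; last by lia.
have e : (uy.+1 - (uy - my) = my.+1)%N by lia.
by rewrite e ifT //; lia.
Qed.

Lemma row_extend_couple b x y mx my :
  row_couple x y mx my -> row_extend b x y mx my = b x y mx my.
Proof.
case=> hy -> hx hmy /andP[hm hm']; rewrite /row_extend hx hmy /=.
case: y hy hx hmy hm' => //= y _ hx hmy hm'.
have -> : (y.+1 - (y.+1 - my) = my)%N by lia.
rewrite ifF; last by lia.
rewrite ifF; last by have := L_anti (leqnSn y); lia.
by congr (b _ _ _ _); lia.
Qed.

Lemma row_extend_left b ux uy mx my : (mx < ux)%N -> row_extend b ux uy mx my = 0.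
Proof. by move=> h; rewrite /row_extend leqNgt h. Qed.

End Rows.

(** * Base change and structure constants *)

Section Ideals.
Variables (A B C : comNzRingType).

Lemma ideal_sub (J : set {mpoly A[2]}) f g : ideal J -> J f -> J g -> J (f - g).
Proof.
by case=> _ JD JM Jf Jg; apply: JD => //; rewrite -mulN1r; apply: JM.
Qed.

Lemma ideal_scale (J : set {mpoly A[2]}) c f : ideal J -> J f -> J (c *: f).
Proof. by case=> _ _ JM Jf; rewrite -mul_mpolyC; apply: JM. Qed.

Lemma ideal_sum (J : set {mpoly A[2]}) (I : eqType) (r : seq I)
    (F : I -> {mpoly A[2]}) :
  ideal J -> (forall i, i \in r -> J (F i)) -> J (\sum_(i <- r) F i).
Proof.
case=> J0 JD _ JF; rewrite big_seq; apply: (big_ind J) => //.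
Qed.

Lemma ideal_congr (J : set {mpoly A[2]}) f g :
  ideal J -> J (f - g) -> J f <-> J g.
Proof.
move=> idJ Jfg; split=> [Jf|Jg].
  by rewrite -(subKr f g); apply: ideal_sub.
by rewrite -(subrK g f); case: idJ => _ JD _; apply: JD.
Qed.

Lemma base_change_mem (h : {rmorphism A -> B}) (J : set {mpoly A[2]}) f :
  J f -> base_change h J (map_mpoly h f).
Proof. by move=> Jf K idK; apply; exists f. Qed.

(** Base change is transitive. *)
Lemma base_change_comp (h1 : {rmorphism A -> B}) (h2 : {rmorphism B -> C})
    (h : {rmorphism A -> C}) (J : set {mpoly A[2]}) :
  (forall x, h2 (h1 x) = h x) ->
  base_change h2 (base_change h1 J) = base_change h J.
Proof.
move=> hE.
have mapE f : map_mpoly h2 (map_mpoly h1 f) = map_mpoly h f.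
  by apply/mpolyP => m; rewrite !mcoeff_map_mpoly /= hE.
apply/seteqP; split=> f Jf K idK JK.
  apply: Jf => // _ [g Jg <-].
  apply: (Jg [set p | K (map_mpoly h2 p)]%classic) => [|_ [p Jp <-]]; last first.
    by rewrite /= mapE; apply: JK; exists p.
  case: idK => K0 KD KM; split=> [|p q Kp Kq|p q Kq] /=; first by rewrite raddf0.
    by rewrite raddfD; apply: KD.
  by rewrite rmorphM; apply: KM.
apply: Jf => // _ [g Jg <-]; rewrite -mapE.
by apply: JK; exists (map_mpoly h1 g) => //; apply: base_change_mem.
Qed.

End Ideals.

Section NormalForm.
Variables (A : comNzRingType) (E : {fset 'X_{1..2}}).
Implicit Types (g : 'X_{1..2} -> 'X_{1..2} -> A) (m u : 'X_{1..2}).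

(** For g u m the coefficient on x^m of the normal form of x^u, [nf_coef g m f] is
    the coefficient on x^m of the normal form of f. *)
Definition nf_coef g m (f : {mpoly A[2]}) : A :=
  \sum_(u <- msupp f) f@_u * g u m.

Lemma nf_coefE g m f (s : seq 'X_{1..2}) :
  uniq s -> {subset msupp f <= s} -> nf_coef g m f = \sum_(u <- s) f@_u * g u m.
Proof.
move=> us sub; rewrite [RHS](bigID (mem (msupp f))) /= [X in _ + X]big1 => [|u].
  rewrite addr0 -big_filter; apply: perm_big; apply: uniq_perm.
  - exact: msupp_uniq.
  - exact: filter_uniq.
  by move=> u; rewrite mem_filter; case: (boolP (u \in msupp f)) => // /sub ->.
by move/memN_msupp_eq0 ->; rewrite mul0r.
Qed.

Fact nf_coef_linear g m : linear_for *%R (nf_coef g m).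
Proof.
move=> c p q; pose s := undup (msupp p ++ msupp q ++ msupp (c *: p + q)).
have us : uniq s by exact: undup_uniq.
have sp : {subset msupp p <= s} by move=> u; rewrite mem_undup !mem_cat => ->.
have sq : {subset msupp q <= s}.
  by move=> u; rewrite mem_undup !mem_cat => ->; rewrite orbT.
have spq : {subset msupp (c *: p + q) <= s}.
  by move=> u; rewrite mem_undup !mem_cat => ->; rewrite !orbT.
rewrite (nf_coefE g m us sp) (nf_coefE g m us sq) (nf_coefE g m us spq).
rewrite mulr_sumr -big_split /=; apply: eq_bigr => u _.
by rewrite mcoeffD mcoeffZ mulrDl mulrA.
Qed.

HB.instance Definition _ g m :=
  GRing.isLinear.Build A {mpoly A[2]} A *%R (nf_coef g m) (nf_coef_linear g m).

Lemma nf_coefZ g m c f : nf_coef g m (c *: f) = c * nf_coef g m f.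
Proof. exact: linearZ. Qed.

Lemma nf_coefX g m u : nf_coef g m 'X_[u] = g u m.
Proof. by rewrite /nf_coef msuppX big_seq1 mcoeffX eqxx mul1r. Qed.

(** g gives the structure constants of a quotient of the polynomial ring in which
    the monomials of E form a basis: g is the identity on E, and the normal form
    of x_i x^u is computed from that of x^u. *)
Definition structure_consts g : Prop :=
  (forall u m, u \in E -> m \in E -> g u m = (u == m)%:R) /\
  (forall u i m, m \in E ->
     g (u + U_(i))%MM m = \sum_(m' <- E) g u m' * g (m' + U_(i))%MM m).

(** The polynomials with normal form 0. *)
Definition nf_kernel g : set {mpoly A[2]} :=
  [set f | forall m, m \in E -> nf_coef g m f = 0]%classic.

Definition normal_form g (f : {mpoly A[2]}) : {mpoly A[2]} :=
  \sum_(m <- E) nf_coef g m f *: 'X_[m].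

Lemma sub_normal_form g f :
  f - normal_form g f =
  \sum_(u <- msupp f) f@_u *: ('X_[u] - normal_form g 'X_[u]).
Proof.
under [RHS]eq_bigr do rewrite scalerBr.
rewrite sumrB -mpolyE; congr (_ - _).
rewrite /normal_form; under [RHS]eq_bigr do rewrite scaler_sumr.
rewrite exchange_big /=; apply: eq_bigr => m _.
by rewrite scaler_suml; apply: eq_bigr => u _; rewrite nf_coefX scalerA.
Qed.

Section Consts.
Variable g : 'X_{1..2} -> 'X_{1..2} -> A.
Hypothesis scg : structure_consts g.

Lemma nf_coef_sum (c : 'X_{1..2} -> A) m :
  m \in E -> nf_coef g m (\sum_(m' <- E) c m' *: 'X_[m']) = c m.
Proof.
move=> mE; rewrite linear_sum /= (bigD1_seq m) ?fset_uniq //=.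
rewrite linearZ /= nf_coefX scg.1 // eqxx mulr1 big_seq_cond big1 ?addr0 //.
move=> m' /andP[m'E ne]; rewrite linearZ /= nf_coefX scg.1 //.
by rewrite (negbTE ne) mulr0.
Qed.

Lemma nf_kernel_sub f : nf_kernel g (f - normal_form g f).
Proof. by move=> m mE; rewrite linearB /= nf_coef_sum // subrr. Qed.

Lemma nf_coef_mulX i m f : m \in E ->
  nf_coef g m ('X_i * f) = \sum_(m' <- E) nf_coef g m' f * g (m' + U_(i))%MM m.
Proof.
move=> mE; rewrite {1}(mpolyE f) mulr_sumr linear_sum /=.
transitivity (\sum_(u <- msupp f) \sum_(m' <- E)
    f@_u * g u m' * g (m' + U_(i))%MM m).
  apply: eq_bigr => u _; rewrite -scalerAr nf_coefZ -mpolyXD nf_coefX addmC.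
  by rewrite scg.2 // mulr_sumr; apply: eq_bigr => m' _; rewrite mulrA.
rewrite exchange_big /=; apply: eq_bigr => m' _.
by rewrite -mulr_suml.
Qed.

Lemma nf_kernel_ideal : ideal (nf_kernel g).
Proof.
split=> [m mE|p q Jp Jq m mE|f p].
- by rewrite linear0.
- by rewrite linearD /= Jp // Jq // addr0.
(* The f with f * nf_kernel g contained in nf_kernel g form a subalgebra, so the
   variables suffice. *)
pose Q f := forall p, nf_kernel g p -> nf_kernel g (f * p).
move: f p; rewrite -/(Q _).
have QD f1 f2 : Q f1 -> Q f2 -> Q (f1 + f2).
  by move=> h1 h2 p Jp m mE; rewrite mulrDl linearD /= h1 // h2 // addr0.
have QM f1 f2 : Q f1 -> Q f2 -> Q (f1 * f2).
  by move=> h1 h2 p Jp; rewrite -mulrA; apply/h1/h2.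
have Q1 : Q 1 by move=> p; rewrite mul1r.
have QX i : Q 'X_i.
  move=> p Jp m mE; rewrite nf_coef_mulX // big_seq big1 // => m' m'E.
  by rewrite Jp // mul0r.
have QXn i k : Q ('X_i ^+ k).
  by elim: k => [|k IH]; rewrite ?expr0 // exprS; apply: QM.
have QXm u : Q 'X_[u].
  by rewrite mpolyXE_id; apply: (big_ind Q).
move=> f; rewrite (mpolyE f); apply: (big_ind Q) => // [p _ m mE|u _ p Jp m mE].
  by rewrite mul0r linear0.
by rewrite -scalerAl nf_coefZ QXm // mulr0.
Qed.

(** The quotient by [nf_kernel g] is free on the monomials of E. *)
Lemma nf_kernel_hilb : hilb (nf_kernel g).
Proof.
split; first exact: nf_kernel_ideal.
pose b (i : 'I_(size E)) : {mpoly A[2]} := 'X_[tnth (in_tuple E) i].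
have bE (a : {ffun 'I_(size E) -> A}) (i : 'I_(size E)) :
    nf_coef g (tnth (in_tuple E) i) (\sum_j a j *: b j) = a i.
  rewrite linear_sum (bigD1 i) //= linearZ /= nf_coefX.
  have tE j : tnth (in_tuple E) j \in E by exact: mem_tnth.
  rewrite scg.1 // eqxx mulr1 big1 ?addr0 // => j ne.
  rewrite linearZ /= nf_coefX scg.1 //.
  rewrite !(tnth_nth 0%MM) nth_uniq ?fset_uniq //.
  by rewrite -val_eqE /= in ne; rewrite (negbTE ne) mulr0.
exists (size E), b => f.
have PE (a : {ffun 'I_(size E) -> A}) : nf_kernel g (f - \sum_i a i *: b i) <->
    forall i, nf_coef g (tnth (in_tuple E) i) f = a i.
  split=> [h i|h m mE].
    have := h _ (mem_tnth i (in_tuple E)).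
    by rewrite linearB /= bE => /eqP; rewrite subr_eq0 => /eqP.
  have /tnthP[i ->] : m \in in_tuple E by [].
  by rewrite linearB /= bE h subrr.
exists [ffun i => nf_coef g (tnth (in_tuple E) i) f]; split.
  by apply/PE => i; rewrite ffunE.
by move=> a /PE h; apply/ffunP => i; rewrite ffunE h.
Qed.

End Consts.
End NormalForm.

Lemma nf_coef_map (A B : comNzRingType) (h : {rmorphism A -> B})
    (g : 'X_{1..2} -> 'X_{1..2} -> A) (g' : 'X_{1..2} -> 'X_{1..2} -> B) m f :
    (forall u, h (g u m) = g' u m) ->
  nf_coef g' m (map_mpoly h f) = h (nf_coef g m f).
Proof.
move=> hg; rewrite (@nf_coefE _ _ _ _ (msupp f)) ?msupp_uniq //; last first.
  move=> u; rewrite !mcoeff_msupp mcoeff_map_mpoly.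
  by apply: contra => /eqP ->; rewrite raddf0.
rewrite raddf_sum /=; apply: eq_bigr => u _.
by rewrite mcoeff_map_mpoly rmorphM /= hg.
Qed.

Lemma base_change_nf_kernel (A B : comNzRingType) (h : {rmorphism A -> B})
    (E : {fset 'X_{1..2}}) (g : 'X_{1..2} -> 'X_{1..2} -> A)
    (g' : 'X_{1..2} -> 'X_{1..2} -> B) :
    structure_consts E g -> structure_consts E g' ->
    (forall u m, m \in E -> h (g u m) = g' u m) ->
  base_change h (nf_kernel E g) = nf_kernel E g'.
Proof.
move=> scg scg' hg; apply/seteqP; split=> [f|f].
  apply; first exact: nf_kernel_ideal.
  move=> _ [p Jp <-] m mE; rewrite (@nf_coef_map _ _ h g) // => [|u].
    by rewrite Jp // rmorph0.
  exact: hg.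
move=> Jf K idK KJ.
have nf0 : normal_form E g' f = 0.
  by rewrite /normal_form big_seq big1 // => m mE; rewrite Jf // scale0r.
rewrite -[f]subr0 -nf0 sub_normal_form; apply: ideal_sum => // u _.
apply: ideal_scale => //; apply: KJ.
exists ('X_[u] - normal_form E g 'X_[u]); first exact: nf_kernel_sub.
rewrite rmorphB /= map_mpolyX; congr (_ - _).
rewrite /normal_form rmorph_sum /= big_seq [RHS]big_seq; apply: eq_bigr => m mE.
by rewrite map_mpolyZ map_mpolyX !nf_coefX hg.
Qed.

Lemma structure_consts_map (A B : comNzRingType) (h : {rmorphism A -> B})
    (E : {fset 'X_{1..2}}) (g : 'X_{1..2} -> 'X_{1..2} -> A) :
  structure_consts E g -> structure_consts E (fun u m => h (g u m)).
Proof.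
move=> [gE gX]; split=> [u m uE mE|u i m mE]; first by rewrite gE // rmorph_nat.
by rewrite gX // rmorph_sum; apply: eq_bigr => m' _; rewrite rmorphM.
Qed.

(** * Ideals whose quotient has a monomial basis *)

Section MonomialBasis.
Variables (A : comNzRingType) (E : {fset 'X_{1..2}}) (J : set {mpoly A[2]}).

(** The class of f modulo J is a combination of monomials of E. *)
Definition spanned (f : {mpoly A[2]}) : Prop :=
  exists c : 'X_{1..2} -> A, J (f - \sum_(m <- E) c m *: 'X_[m]).

(** The monomials of E are linearly independent modulo J. *)
Definition independent : Prop :=
  forall c : 'X_{1..2} -> A, J (\sum_(m <- E) c m *: 'X_[m]) ->
    forall m, m \in E -> c m = 0.

Hypothesis idJ : ideal J.

Lemma spanned_mem f : J f -> spanned f.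
Proof.
by move=> Jf; exists (fun=> 0); rewrite big1 ?subr0 // => m _; rewrite scale0r.
Qed.

Lemma spannedD f g : spanned f -> spanned g -> spanned (f + g).
Proof.
move=> [c Jc] [d Jd]; exists (fun m => c m + d m).
under eq_bigr do rewrite scalerDl.
by rewrite big_split /= opprD addrACA; case: idJ => _ JD _; apply: (JD).
Qed.

Lemma spanned_comb (c : 'X_{1..2} -> A) :
  spanned (\sum_(m <- E) c m *: 'X_[m]).
Proof. by exists c; rewrite subrr; case: idJ. Qed.

Lemma spanned_sum (I : Type) (r : seq I) (F : I -> {mpoly A[2]}) :
  (forall i, spanned (F i)) -> spanned (\sum_(i <- r) F i).
Proof.
move=> sF; apply: (big_ind spanned) => // [|f g]; last exact: spannedD.
by apply: spanned_mem; case: idJ.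
Qed.

Lemma independentP (c d : 'X_{1..2} -> A) : independent ->
  J (\sum_(m <- E) c m *: 'X_[m] - \sum_(m <- E) d m *: 'X_[m]) ->
  forall m, m \in E -> c m = d m.
Proof.
move=> iJ; rewrite -sumrB; under eq_bigr do rewrite -scalerBl.
by move=> /iJ h m /h /eqP; rewrite subr_eq0 => /eqP.
Qed.

(** An ideal J for which the monomials of E form a basis of the quotient is
    determined by its structure constants. *)
Lemma monomial_basis_kernel :
    (forall f, spanned f) -> independent ->
  exists g, [/\ structure_consts E g, J = nf_kernel E g &
                forall u, J ('X_[u] - \sum_(m <- E) g u m *: 'X_[m])].
Proof.
move=> sp ind; pose g u := projT1 (cid (sp 'X_[u])).
have Jg u : J ('X_[u] - \sum_(m <- E) g u m *: 'X_[m]) by rewrite /g; case: cid.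
exists g; split=> //; last first.
  apply/seteqP; split=> f.
    have Jf : J (f - normal_form E g f).
      rewrite sub_normal_form; apply: ideal_sum => // u _; apply: ideal_scale => //.
      have := Jg u; congr (J (_ - _)); apply: eq_bigr => m _.
      by rewrite nf_coefX.
    by move=> /(ideal_congr idJ Jf) /ind.
  move=> Jf; have -> : f = f - normal_form E g f.
    rewrite [X in _ - X](_ : _ = 0) ?subr0 //.
    by rewrite /normal_form big_seq big1 // => m mE; rewrite Jf // scale0r.
  rewrite sub_normal_form; apply: ideal_sum => // u _; apply: ideal_scale => //.
  have := Jg u; congr (J (_ - _)); apply: eq_bigr => m _.
  by rewrite nf_coefX.
split=> [u m uE mE|u i m mE].
  apply: (@independentP (g u) (fun m => (u == m)%:R)) => //.
  have -> : \sum_(m0 <- E) (u == m0)%:R *: 'X_[m0] = 'X_[u] :> {mpoly A[2]}.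
    rewrite (bigD1_seq u) ?fset_uniq //= eqxx scale1r big1 ?addr0 // => v ne.
    by rewrite eq_sym (negbTE ne) scale0r.
  by rewrite -opprB -scaleN1r; apply: ideal_scale.
apply: (@independentP (g (u + U_(i))%MM)
   (fun m => \sum_(m' <- E) g u m' * g (m' + U_(i))%MM m)) => //.
have [_ JD JM] := idJ.
have -> : \sum_(m0 <- E) (\sum_(m' <- E) g u m' * g (m' + U_(i))%MM m0) *: 'X_[m0]
  = \sum_(m' <- E) g u m' *: \sum_(m0 <- E) g (m' + U_(i))%MM m0 *: 'X_[m0]
  :> {mpoly A[2]}.
  under [RHS]eq_bigr do rewrite scaler_sumr.
  rewrite exchange_big; apply: eq_bigr => m' _.
  by rewrite scaler_suml; apply: eq_bigr => v _; rewrite scalerA.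
rewrite -[X in J X](subrKA ('X_[u + U_(i)])) -opprB.
apply: (JD); first by rewrite -scaleN1r; apply: ideal_scale.
rewrite -[X in J X](subrKA ('X_i * \sum_(m' <- E) g u m' *: 'X_[m'])).
apply: (JD).
  by rewrite addmC mpolyXD -mulrBr; apply: (JM).
rewrite mulr_sumr -sumrB; apply: ideal_sum => // m' _.
rewrite -scalerAr -scalerBr; apply: ideal_scale => //.
by rewrite -mpolyXD addmC.
Qed.

End MonomialBasis.

(** * Deformations of a monomial ideal *)

Section DualNumbers.
Variables (k : fieldType) (n : nat).
Local Notation A := (dual k n).
Local Notation aug := (@dual_aug k n).

Lemma dual_eq (x y : A) : x.1 = y.1 -> x.2 = y.2 -> x = y.
Proof. by case: x y => [a u] [b v] /= -> ->. Qed.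

(** Multiplication by an element of the maximal ideal only sees the residue of the
    other factor, because the maximal ideal has square 0. *)
Lemma dual_aug0_mul (x y : A) : aug x = 0 -> x * y = (0, aug y *: x.2).
Proof.
case: x y => [a u] [b v]; rewrite /dual_aug /= => ->.
by apply: dual_eq; rewrite /= ?mul0r // scale0r add0r.
Qed.

Lemma dual_sum2 (I : Type) (r : seq I) (F : I -> A) :
  (\sum_(i <- r) F i).2 = \sum_(i <- r) (F i).2.
Proof. exact: (big_morph (fun x : A => x.2)). Qed.

Lemma map_aug_lift (f : {mpoly k[2]}) :
  exists F : {mpoly A[2]}, map_mpoly aug F = f.
Proof.
exists (\sum_(u <- msupp f) ((f@_u, 0) : A) *: 'X_[u]).
rewrite raddf_sum [RHS]mpolyE /=; apply: eq_bigr => u _.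
by rewrite map_mpolyZ map_mpolyX.
Qed.

Lemma base_change_aug_image (J : set {mpoly A[2]}) f : ideal J ->
  base_change aug J f -> exists2 F, J F & map_mpoly aug F = f.
Proof.
move=> [J0 JD JM].
move=> /(_ [set p | exists2 F, J F & map_mpoly aug F = p]%classic); apply=> //.
split=> [|_ _ [F JF <-] [G JG <-]|p _ [G JG <-]].
- by exists 0; rewrite ?raddf0.
- by exists (F + G); rewrite ?raddfD //; apply: (JD).
- have [P <-] := map_aug_lift p.
  by exists (P * G); rewrite ?rmorphM //; apply: (JM).
Qed.

Lemma map_aug_comb (s : seq 'X_{1..2}) (c : 'X_{1..2} -> A) :
  map_mpoly aug (\sum_(m <- s) c m *: 'X_[m]) = \sum_(m <- s) aug (c m) *: 'X_[m].
Proof.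
rewrite raddf_sum /=; apply: eq_bigr => m _.
by rewrite map_mpolyZ map_mpolyX.
Qed.

Lemma mcoeff_comb (R : comNzRingType) (E : {fset 'X_{1..2}})
    (c : 'X_{1..2} -> R) m :
  (\sum_(m' <- E) c m' *: 'X_[m'])@_m = if m \in E then c m else 0.
Proof.
rewrite raddf_sum /=; case: ifP => mE.
  rewrite (bigD1_seq m) ?fset_uniq //= mcoeffZ mcoeffX eqxx mulr1 big1 ?addr0 //.
  by move=> v ne; rewrite mcoeffZ mcoeffX (negbTE ne) mulr0.
rewrite big_seq big1 // => v vE; rewrite mcoeffZ mcoeffX.
by case: eqP vE mE => [->->|]; rewrite ?mulr0.
Qed.

Variable E : {fset 'X_{1..2}}.

Lemma monomial_idealP (f : {mpoly k[2]}) :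
  monomial_ideal k E f <-> forall m, m \in E -> f@_m = 0.
Proof.
split=> [h m mE|h m]; last by rewrite mcoeff_msupp; apply: contra => /h ->.
by apply/eqP; rewrite mcoeff_eq0; apply/negP => /h; rewrite mE.
Qed.

Section Lift.
Variable J : set {mpoly A[2]}.
Hypothesis hJ : hilb J.
Hypothesis bJ : base_change aug J = monomial_ideal k E.
Let idJ : ideal J := hJ.1.

Lemma aug_mem_coef F m : J F -> m \in E -> aug F@_m = 0.
Proof.
move=> JF mE; have := base_change_mem (h := aug) JF; rewrite bJ => /monomial_idealP.
by move=> /(_ m mE); rewrite mcoeff_map_mpoly.
Qed.

(** Division by the monomials of E is possible modulo the maximal ideal. *)
Lemma spanned_mod_eps f :
  exists c r, J (f - \sum_(m <- E) c m *: 'X_[m] - r) /\ map_mpoly aug r = 0.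
Proof.
pose f0 := map_mpoly aug f; pose c m : A := (f0@_m, 0).
have : base_change aug J (f0 - \sum_(m <- E) f0@_m *: 'X_[m]).
  rewrite bJ; apply/monomial_idealP => m mE.
  by rewrite mcoeffB mcoeff_comb mE subrr.
move=> /(base_change_aug_image idJ)[F JF FE].
exists c, (f - \sum_(m <- E) c m *: 'X_[m] - F); split; first by rewrite subKr.
by rewrite !raddfB /= map_aug_comb FE subrr.
Qed.

(** Nakayama's lemma for a maximal ideal of square 0: the monomials of E span the
    quotient. *)
Lemma spanned_all f : spanned E J f.
Proof.
(* If r has coefficients in the maximal ideal, then a second division of each of
   its monomials leaves a remainder killed by these coefficients. *)
have spE r : map_mpoly aug r = 0 -> spanned E J r.
  move=> r0; rewrite (mpolyE r); apply: spanned_sum => // u.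
  have [c [r' [Jr' r'0]]] := spanned_mod_eps 'X_[u].
  have e0 : aug r@_u = 0 by rewrite -mcoeff_map_mpoly r0 mcoeff0.
  exists (fun m => r@_u * c m); under eq_bigr do rewrite -scalerA.
  rewrite -scaler_sumr -scalerBr.
  suff er : r@_u *: r' = 0.
    by have := ideal_scale r@_u idJ Jr'; rewrite [X in J X -> _]scalerBr er subr0.
  apply/mpolyP => m; rewrite mcoeffZ mcoeff0 dual_aug0_mul //.
  by rewrite -mcoeff_map_mpoly r'0 mcoeff0 scale0r.
have [c [r [Jr r0]]] := spanned_mod_eps f.
rewrite -(subrK r f) -(subrK (\sum_(m <- E) c m *: 'X_[m]) (f - r)).
apply: spannedD => //; last exact: spE.
apply: spannedD => //; last exact: spanned_comb.
by apply: spanned_mem; rewrite addrAC.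
Qed.

(** This uses that the quotient is free: for a relation c between the monomials of
    E, all c m are in the maximal ideal. If T and S express the monomials in the
    given basis b and conversely, then c T = 0 by freeness of b, while T S is the
    identity modulo the maximal ideal, whence c = c (T S) = 0. *)
Lemma independent_all : independent E J.
Proof.
move=> c Jc.
have c0 m : m \in E -> aug (c m) = 0.
  by move=> mE; have := aug_mem_coef Jc mE; rewrite mcoeff_comb mE.
have [_ [N [b basisb]]] := hJ.
have /choice[T JT] : forall m, exists t : 'I_N -> A,
    J ('X_[m] - \sum_i t i *: b i).
  by move=> m; have [t [Jt _]] := basisb 'X_[m]; exists t.
have /choice[S JS] : forall i, exists s : 'X_{1..2} -> A,
    J (b i - \sum_(m <- E) s m *: 'X_[m]).
  by move=> i; apply: spanned_all.
have cT i : \sum_(m <- E) c m * T m i = 0.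
  have [a [_ ua]] := basisb 0.
  have [_ JD _] := idJ.
  have e1 : a = [ffun i => - \sum_(m <- E) c m * T m i].
    apply: ua; rewrite sub0r -sumrN.
    have -> : \sum_(i < N) - ([ffun i => - \sum_(m <- E) c m * T m i] i *: b i) =
        \sum_(m <- E) c m *: 'X_[m] -
        \sum_(m <- E) c m *: ('X_[m] - \sum_i T m i *: b i).
      rewrite -sumrB; under [RHS]eq_bigr do rewrite -scalerBr subKr scaler_sumr.
      rewrite exchange_big; apply: eq_bigr => j _; rewrite ffunE scaleNr opprK.
      by rewrite scaler_suml; apply: eq_bigr => m _; rewrite scalerA.
    apply: ideal_sub => //; apply: ideal_sum => // m _; exact: ideal_scale.
  have e2 : a = [ffun => 0].
    apply: ua; rewrite big1 ?subrr; first by case: idJ.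
    by move=> j _; rewrite ffunE scale0r.
  by have := congr1 (fun h : {ffun 'I_N -> A} => h i) (etrans (esym e1) e2);
    rewrite !ffunE => /eqP; rewrite oppr_eq0 => /eqP.
have TS m m' : m' \in E -> aug (\sum_i T m i * S i m') = (m == m')%:R.
  move=> m'E.
  have JTS : J ('X_[m] - \sum_(m' <- E) (\sum_i T m i * S i m') *: 'X_[m']).
    have -> : 'X_[m] - \sum_(m' <- E) (\sum_i T m i * S i m') *: 'X_[m'] =
      ('X_[m] - \sum_i T m i *: b i) +
      \sum_i T m i *: (b i - \sum_(m' <- E) S i m' *: 'X_[m']).
      under [\sum_i T m i *: (_ - _)]eq_bigr do rewrite scalerBr.
      rewrite sumrB addrA subrK; congr (_ - _).
      under [RHS]eq_bigr do rewrite scaler_sumr.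
      rewrite exchange_big; apply: eq_bigr => v _.
      by rewrite scaler_suml; apply: eq_bigr => j _; rewrite scalerA.
    have [_ JD _] := idJ; apply: (JD) => //; apply: ideal_sum => // i _.
    exact: ideal_scale.
  have := aug_mem_coef JTS m'E; rewrite mcoeffB mcoeff_comb m'E mcoeffX.
  by move/eqP; rewrite raddfB /= subr_eq0 => /eqP <-; case: eqP.
move=> m' m'E.
transitivity (\sum_(m <- E) c m * \sum_i T m i * S i m').
  rewrite (bigD1_seq m') ?fset_uniq //= dual_aug0_mul ?c0 // TS // eqxx scale1r.
  rewrite big_seq_cond big1 ?addr0 => [|m /andP[mE ne]].
    by apply: dual_eq => //=; apply: c0.
  by rewrite dual_aug0_mul ?c0 // TS // (negbTE ne) scale0r.
under eq_bigr do rewrite mulr_sumr.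
rewrite exchange_big /= big1 // => i _.
by under eq_bigr do rewrite mulrA; rewrite -mulr_suml cT mul0r.
Qed.

End Lift.

(** The structure constants of the deformation of the monomial ideal of E given by
    a: for u outside of E, the monomial x^u has normal form the sum over m in E of
    (a u m) x^m, the vector a u m being read in the maximal ideal. *)
Definition tangent_consts (a : 'X_{1..2} -> 'X_{1..2} -> 'rV[k]_n) u m : A :=
  if u \in E then (u == m)%:R else ((0, a u m) : A).

(** The coefficients a u m of x^m in the image of x^u, for u outside of E and m in
    E, define a homomorphism from the monomial ideal I to the quotient by I. The
    other values of a are irrelevant. *)
Definition hom_coefs (V : nmodType) (a : 'X_{1..2} -> 'X_{1..2} -> V) : Prop :=
  forall u i m, u \notin E -> m \in E ->
    a (u + U_(i))%MM m = if (U_(i) <= m)%MM then a u (m - U_(i))%MM else 0.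

Hypothesis hE : staircase E.

(** Modulo the maximal ideal, the normal form of a monomial outside of E is 0. *)
Lemma aug_tangent_consts a u m :
  m \in E -> aug (tangent_consts a u m) = (u == m)%:R.
Proof.
move=> mE; rewrite /tangent_consts; case: ifP => uE; first by rewrite rmorph_nat.
by case: eqP uE mE => // -> ->.
Qed.

(** In the quotient by the monomial ideal, the coefficient on x^m of the product of
    x_i and the sum over m' in E of (b m') x^m'. *)
Lemma hom_coefs_sum (V : lmodType k) (b : 'X_{1..2} -> V) i m : m \in E ->
  \sum_(m' <- E) ((m' + U_(i))%MM == m)%:R *: b m' =
  if (U_(i) <= m)%MM then b (m - U_(i))%MM else 0.
Proof.
move=> mE; case: ifP => im.
  have mi : (m - U_(i))%MM \in E.
    by apply: contraLR mE => miE; rewrite -(submK im); apply: hE.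
  rewrite (bigD1_seq (m - U_(i))%MM) ?fset_uniq //= submK // eqxx scale1r.
  rewrite big1 ?addr0 // => v ne; case: eqP => [e|]; last by rewrite scale0r.
  by case/eqP: ne; rewrite -e addmK.
rewrite big1 // => v _; case: eqP => [e|]; last by rewrite scale0r.
by rewrite -e lem_addl in im.
Qed.

Lemma tangent_consts_structure a :
  hom_coefs a -> structure_consts E (tangent_consts a).
Proof.
move=> ha; split=> [u m uE mE|u i m mE]; first by rewrite /tangent_consts uE.
rewrite {2}/tangent_consts; case: (boolP (u \in E)) => uE.
  rewrite (bigD1_seq u) ?fset_uniq //= eqxx mul1r big1 ?addr0 // => v ne.
  by rewrite eq_sym (negbTE ne) mul0r.
rewrite {1}/tangent_consts (negbTE (hE _ uE)); apply: dual_eq.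
  under eq_bigr do rewrite dual_aug0_mul //.
  by rewrite -/(aug _) raddf_sum /= big1.
rewrite dual_sum2 [LHS]/= ha // -hom_coefs_sum //; apply: eq_bigr => v _.
by rewrite dual_aug0_mul // [RHS]/= aug_tangent_consts.
Qed.

(** Every deformation of the monomial ideal comes from a homomorphism. *)
Lemma hilb_tangent_consts J :
    hilb J -> base_change aug J = monomial_ideal k E ->
  exists2 a, hom_coefs a & J = nf_kernel E (tangent_consts a).
Proof.
move=> hJ bJ.
have [g [scg JE Jg]] :=
  monomial_basis_kernel hJ.1 (spanned_all hJ bJ) (independent_all hJ bJ).
have augg u m : m \in E -> aug (g u m) = (u == m)%:R.
  move=> mE; have := aug_mem_coef bJ (Jg u) mE.
  rewrite mcoeffB mcoeff_comb mE mcoeffX raddfB /= => /eqP.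
  by rewrite subr_eq0 => /eqP <-; case: eqP.
exists (fun u m => (g u m).2).
  move=> u i m uE mE; rewrite scg.2 // dual_sum2.
  rewrite -(hom_coefs_sum (fun v => (g u v).2)) //.
  rewrite big_seq [RHS]big_seq; apply: eq_bigr => v vE.
  rewrite dual_aug0_mul /= ?augg //.
  by case: eqP uE vE => // -> /negbTE ->.
rewrite JE; apply/seteqP; split=> f Jf m mE; rewrite -[RHS](Jf m mE);
  apply: eq_bigr => u _; congr (_ * _); rewrite /tangent_consts.
all: case: ifP => uE; [by rewrite scg.1|].
all: apply: dual_eq => //=; have := augg u m mE; rewrite /dual_aug.
all: by case: eqP uE mE => // -> ->.
Qed.

(** The deformation determines the homomorphism. *)
Lemma tangent_consts_inj a a' : hom_coefs a -> hom_coefs a' ->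
    nf_kernel E (tangent_consts a) = nf_kernel E (tangent_consts a') ->
  forall u m, u \notin E -> m \in E -> a u m = a' u m.
Proof.
move=> ha ha' e u m uE mE.
have := nf_kernel_sub (tangent_consts_structure ha) 'X_[u].
rewrite e => /(_ m mE); rewrite linearB /=.
rewrite nf_coef_sum //; last exact: tangent_consts_structure.
rewrite !nf_coefX /tangent_consts (negbTE uE) => /eqP; rewrite subr_eq0.
by move=> /eqP[].
Qed.

Lemma base_change_aug_consts a : hom_coefs a ->
  base_change aug (nf_kernel E (tangent_consts a)) = monomial_ideal k E.
Proof.
move=> ha; have scg := tangent_consts_structure ha.
rewrite (base_change_nf_kernel (h := aug) scg (structure_consts_map aug scg)) //.
apply/seteqP; split=> f h; [apply/monomial_idealP|] => m mE.
  rewrite -[RHS](h m mE) {1}(mpolyE f) raddf_sum; apply: eq_bigr => u _.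
  by rewrite /= mcoeffZ mcoeffX aug_tangent_consts.
have /monomial_idealP/(_ m mE) <- := h.
rewrite {2}(mpolyE f) raddf_sum; apply: eq_bigr => u _.
by rewrite /= mcoeffZ mcoeffX aug_tangent_consts.
Qed.

End DualNumbers.

Lemma base_change_tangent_consts (k : fieldType) (n n' : nat) (M : 'M[k]_(n, n'))
    (E : {fset 'X_{1..2}}) (hE : staircase E)
    (a : 'X_{1..2} -> 'X_{1..2} -> 'rV[k]_n)
    (a' : 'X_{1..2} -> 'X_{1..2} -> 'rV[k]_n') :
    hom_coefs E a -> hom_coefs E a' ->
    (forall u m, u \notin E -> m \in E -> a' u m = a u m *m M) ->
  base_change (dual_map M) (nf_kernel E (tangent_consts E a)) =
  nf_kernel E (tangent_consts E a').
Proof.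
move=> ha ha' e; apply: base_change_nf_kernel; try exact: tangent_consts_structure.
move=> u m mE; rewrite /tangent_consts; case: (boolP (u \in E)) => uE.
  by rewrite rmorph_nat.
by rewrite e.
Qed.

(** * Rows, columns and clefts of a staircase *)

(** The monomial with exponent x in the variable i and y in the other one. *)
Definition mon (i : 'I_2) (x y : nat) : 'X_{1..2} :=
  [multinom if l == i then x else y | l < 2].

(** The number of monomials of the staircase E with exponent t in the variable j, i
    being the other variable: the length of a row for (i, j) = (0, 1), the height
    of a column for (i, j) = (1, 0). *)
Definition line_length (E : {fset 'X_{1..2}}) (i j : 'I_2) (t : nat) : nat :=
  \max_(m <- E | m j == t) (m i).+1.

(** This is the order >_+ for (i, j) = (0, 1) and the order >_- for
    (i, j) = (1, 0). *)
Definition gt_lex (i j : 'I_2) (m n : 'X_{1..2}) : Prop :=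
  (n i < m i)%N \/ m i = n i /\ (n j < m j)%N.

Lemma staircase_le (E : {fset 'X_{1..2}}) m n :
  staircase E -> (m <= n)%MM -> n \in E -> m \in E.
Proof.
move=> hE mn; apply: contraLR => mE.
by rewrite -(submK mn) addmC; apply: hE.
Qed.

Section Lines.
Variables (E : {fset 'X_{1..2}}) (hE : staircase E) (i j : 'I_2).
Hypothesis ij : i != j.
Local Notation L := (line_length E i j).
Local Notation H := (line_length E j i).

Lemma ord2P (P : 'I_2 -> Prop) : P i -> P j -> forall l, P l.
Proof.
move=> Pi Pj l; have [->//|li] := eqVneq l i; have [->//|lj] := eqVneq l j.
by move: ij li lj; rewrite -!val_eqE /=; case: i j l => [a ?] [b ?] [c ?] /=; lia.
Qed.

Lemma mon_l x y : mon i x y i = x. Proof. by rewrite mnmE eqxx. Qed.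
Lemma mon_r x y : mon i x y j = y.
Proof. by rewrite mnmE eq_sym (negbTE ij). Qed.

Lemma mnm_ext (m n : 'X_{1..2}) : m i = n i -> m j = n j -> m = n.
Proof. by move=> hi hj; apply/mnmP; apply: ord2P. Qed.

Lemma mon_eta (m : 'X_{1..2}) : mon i (m i) (m j) = m.
Proof. by apply: mnm_ext; rewrite ?mon_l ?mon_r. Qed.

Lemma lemE (m n : 'X_{1..2}) : (m <= n)%MM = (m i <= n i)%N && (m j <= n j)%N.
Proof.
apply/mnm_lepP/andP => [h|[hi hj]]; first by split; apply: h.
exact: ord2P.
Qed.

Lemma mem_line (m : 'X_{1..2}) : (m \in E) = (m i < L (m j))%N.
Proof.
apply/idP/idP => [mE|]; first by apply: (bigmaxn_sup_seq m).
apply: contraLR => mE; rewrite -leqNgt; apply/bigmax_leqP_seq => n nE /eqP nj.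
rewrite ltnNge; apply: contra mE => mn.
by apply: staircase_le hE _ nE; rewrite lemE mn nj /=.
Qed.

Lemma mem_mon x y : (mon i x y \in E) = (x < L y)%N.
Proof. by rewrite mem_line mon_l mon_r. Qed.

Lemma line_anti y y' : (y <= y')%N -> (L y' <= L y)%N.
Proof.
move=> yy'; rewrite leqNgt -mem_mon; apply/negP => hE'.
have : mon i (L y) y \in E.
  by apply: staircase_le hE _ hE'; rewrite lemE !mon_l !mon_r leqnn.
by rewrite mem_mon ltnn.
Qed.

End Lines.

Section Clefts.
Variables (E : {fset 'X_{1..2}}) (hE : staircase E) (i j : 'I_2).
Hypothesis ij : i != j.
Local Notation L := (line_length E i j).
Local Notation H := (line_length E j i).
Let ji : j != i. Proof. by rewrite eq_sym. Qed.

Lemma line_swap x y : (x < L y)%N = (y < H x)%N.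
Proof.
rewrite -(mem_mon hE ij) -(mem_mon hE ji); congr (_ \in E).
by apply: (mnm_ext ij); rewrite ?(mon_l i) ?(mon_r ij) ?(mon_l j) ?(mon_r ji).
Qed.

(** Row lengths and column heights form an antitone Galois connection. *)
Lemma line_galois x y : (L y <= x)%N = (H x <= y)%N.
Proof. by rewrite leqNgt line_swap -leqNgt. Qed.

(** The clefts are the corners of the complement of E. *)
Lemma cleft_lineP (c : 'X_{1..2}) : cleft E c <-> c i = L (c j) /\ c j = H (c i).
Proof.
split=> [[cE cmin]|[ci cj]].
  have := cE; rewrite (mem_line hE ij) -leqNgt => Lc.
  have := Lc; rewrite line_galois => Hc; split; apply/eqP.
    rewrite eqn_leq Lc andbT.
    have mE : mon i (L (c j)) (c j) \notin E by rewrite (mem_mon hE ij) ltnn.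
    by rewrite -{1}(cmin _ mE) ?(lemE ij) ?mon_l ?mon_r ?Lc /=.
  rewrite eqn_leq Hc andbT.
  have mE : mon j (H (c i)) (c i) \notin E by rewrite (mem_mon hE ji) ltnn.
  by rewrite -{1}(cmin _ mE) ?(lemE ji) ?mon_l ?mon_r ?Hc /=.
split=> [|m]; first by rewrite (mem_line hE ij) -ci ltnn.
rewrite (mem_line hE ij) -leqNgt (lemE ij) => Lm /andP[mi mj].
have Hm := Lm; rewrite line_galois in Hm.
have := line_anti hE ij mj; have := line_anti hE ji mi => h1 h2.
by apply: (mnm_ext ij); lia.
Qed.

(** The cleft following c for [gt_lex i j]: it begins the step just below c. *)
Definition next_cleft (c : 'X_{1..2}) : 'X_{1..2} :=
  mon i (L (c j).-1) (H (L (c j).-1)).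

Lemma successor_next (c : 'X_{1..2}) : cleft E c -> (0 < c j)%N ->
  successor (gt_lex i j) E c (next_cleft c).
Proof.
move=> /cleft_lineP[ci cj] c0.
have clt : (c i < L (c j).-1)%N by rewrite line_swap; lia.
have Hle y : (H (L y) <= y)%N by rewrite -line_galois.
split.
- apply/cleft_lineP; rewrite /next_cleft mon_l (mon_r ij); split=> //.
  apply/eqP; rewrite eqn_leq (line_anti hE ij (Hle _)) /=.
  by rewrite line_galois.
- by left; rewrite mon_l.
move=> d /cleft_lineP[di dj]; rewrite /gt_lex /next_cleft mon_l (mon_r ij).
case=> [h|[e h]]; last by rewrite dj e -cj ltnn in h.
have := line_anti hE ji (ltnW h); rewrite -cj -dj => hj.
have hj' : (d j <= (c j).-1)%N.
  suff : d j != c j by lia.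
  by apply/eqP => e; rewrite di e -ci ltnn in h.
have := line_anti hE ij hj'; rewrite -di leq_eqVlt.
case/orP=> [/eqP e|]; last by right; left.
by left; apply: (mnm_ext ij); rewrite ?mon_l ?(mon_r ij) // dj e.
Qed.

Lemma successor_uniq (c c1 c2 : 'X_{1..2}) :
  successor (gt_lex i j) E c c1 -> successor (gt_lex i j) E c c2 -> c1 = c2.
Proof.
move=> [cl1 g1 m1] [cl2 g2 m2].
have [e|h1] := m1 _ cl2 g2; first exact: esym.
have [e|h2] := m2 _ cl1 g1; first exact: e.
by exfalso; move: h1 h2; rewrite /gt_lex; lia.
Qed.

(** Significance of a couple with m below c, in terms of row lengths. *)
Lemma significant_for_row (c m : 'X_{1..2}) : cleft E c -> m \in E -> (m j < c j)%N ->
  significant_for (gt_lex i j) E (c, m) <-> row_couple L (c i) (c j) (m i) (m j).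
Proof.
move=> clc mE mc.
have c0 : (0 < c j)%N by lia.
have sc := successor_next clc c0.
have [ci cj] := (cleft_lineP c).1 clc.
have clt : (c i < L (c j).-1)%N by rewrite line_swap; lia.
have Hle : (H (L (c j).-1) <= (c j).-1)%N by rewrite -line_galois.
have LmE : (m i < L (m j))%N by rewrite -(mem_line hE ij).
have nxE : ((m + (mlcm c (next_cleft c) - c))%MM \notin E) =
    (L (m j) <= m i + (L (c j).-1 - c i))%N.
  rewrite (mem_line hE ij) -leqNgt !mnmDE !mnmBE !mnmE eqxx.
  rewrite (eq_sym j) (negbTE ij).
  have -> : (maxn (c j) (H (L (c j).-1)) - c j = 0)%N by lia.
  by rewrite addn0; congr (_ <= _ + _)%N; lia.
split=> [[c' sc' /=]|[_ _ _ _ /andP[_ h]]].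
  rewrite -(successor_uniq sc sc') nxE => h; split=> //; last by rewrite LmE.
  have mc' : (m j <= (c j).-1)%N by lia.
  by have := line_anti hE ij mc'; lia.
by exists (next_cleft c) => //=; rewrite nxE.
Qed.

Lemma row_couple_cleft (c m : 'X_{1..2}) : row_couple L (c i) (c j) (m i) (m j) ->
  cleft E c /\ m \in E.
Proof.
case=> c0 ci cm mc /andP[h1 h2]; rewrite (mem_line hE ij) h1; split=> //.
apply/cleft_lineP; split=> //; apply/eqP; rewrite eqn_leq -line_galois -ci leqnn.
have : (c i < L (c j).-1)%N by lia.
by rewrite line_swap; lia.
Qed.

Section Homs.
Variable V : nmodType.
Implicit Type a : 'X_{1..2} -> 'X_{1..2} -> V.

(** A function of pairs of monomials, in the coordinates (i, j). *)
Definition coord_fun a : arrow_fun V :=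
  fun ux uy mx my => a (mon i ux uy) (mon i mx my).

Lemma monS_l x y : mon i x.+1 y = (mon i x y + U_(i))%MM.
Proof.
by apply: (mnm_ext ij); rewrite mnmDE ?mon_l ?(mon_r ij) mnm1E ?eqxx ?(negbTE ij); lia.
Qed.

Lemma monS_r x y : mon i x y.+1 = (mon i x y + U_(j))%MM.
Proof.
by apply: (mnm_ext ij); rewrite mnmDE ?mon_l ?(mon_r ij) mnm1E ?eqxx ?(negbTE ji); lia.
Qed.

Lemma coord_fun_right a : hom_coefs E a -> stable_right L (coord_fun a).
Proof.
move=> ha ux uy mx my hu hm; rewrite /coord_fun monS_l ha.
- by case: mx hm => [|mx] hm; rewrite lep1mP mon_l //= monS_l addmK.
- by rewrite (mem_mon hE ij) -leqNgt.
- by rewrite (mem_mon hE ij).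
Qed.

Lemma coord_fun_up a : hom_coefs E a -> stable_up L (coord_fun a).
Proof.
move=> ha ux uy mx my hu hm; rewrite /coord_fun monS_r ha.
- by case: my hm => [|my] hm; rewrite lep1mP (mon_r ij) //= monS_r addmK.
- by rewrite (mem_mon hE ij) -leqNgt.
- by rewrite (mem_mon hE ij).
Qed.

Lemma hom_coefs_row_vanish a : hom_coefs E a ->
    (forall c m : 'X_{1..2}, row_couple L (c i) (c j) (m i) (m j) -> a c m = 0) ->
  forall u m, u \notin E -> m \in E -> (m j < u j)%N -> a u m = 0.
Proof.
move=> ha a0 u m; rewrite !(mem_line hE ij) -leqNgt => uE mE mu.
have := row_vanish (line_anti hE ij) (coord_fun_right ha) (coord_fun_up ha) _ uE mE mu.
rewrite /coord_fun !(mon_eta ij); apply=> x y mx my rc.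
by apply: a0; rewrite !mon_l !(mon_r ij).
Qed.

(** The homomorphism with prescribed values on the row couples. *)
Definition row_hom (b : 'X_{1..2} -> 'X_{1..2} -> V) u m : V :=
  row_extend L (coord_fun b) (u i) (u j) (m i) (m j).

Lemma row_hom_coefs b : hom_coefs E (row_hom b).
Proof.
move=> u l m uE mE; move: (uE) (mE); rewrite !(mem_line hE ij) -leqNgt => hu hm.
move: l; apply: (ord2P ij); rewrite /row_hom lep1mP !mnmDE !mnmBE !mnm1E !eqxx.
  rewrite (negbTE ij) addn0 addn1 subn0 row_extend_right //.
  by case: (m i) => //= x; rewrite subn1.
rewrite (negbTE ji) addn0 addn1 subn0 row_extend_up //.
by case: (m j) => //= x; rewrite subn1.
Qed.

Lemma row_hom_couple b (c m : 'X_{1..2}) : row_couple L (c i) (c j) (m i) (m j) ->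
  row_hom b c m = b c m.
Proof.
move=> rc; rewrite /row_hom row_extend_couple //; last exact: line_anti.
by rewrite /coord_fun !(mon_eta ij).
Qed.

Lemma row_hom_left b (c m : 'X_{1..2}) : (m i < c i)%N -> row_hom b c m = 0.
Proof. exact: row_extend_left. Qed.

End Homs.
End Clefts.

(** * Significant couples and homomorphisms *)

(** Every nonzero vector is a positive multiple of a vector with coprime
    coordinates. *)
Lemma half_direction_ex (p q : int) : p != 0 \/ q != 0 ->
  exists t d, [/\ (0 < t), coprimez d.1 d.2, p = t * d.1 & q = t * d.2].
Proof.
move=> pq; have g0 : gcdz p q != 0 by rewrite gcdz_eq0; lia.
have gp : 0 < gcdz p q by rewrite lt0r g0.
exists (gcdz p q), ((p %/ gcdz p q)%Z, (q %/ gcdz p q)%Z).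
have ep : p = gcdz p q * (p %/ gcdz p q)%Z by rewrite mulrC divzK ?dvdz_gcdl.
have eq : q = gcdz p q * (q %/ gcdz p q)%Z by rewrite mulrC divzK ?dvdz_gcdr.
split=> //=; rewrite /coprimez; apply/eqP/(mulfI g0).
by rewrite mulr1 -{1}(gez0_abs (ltW gp)) mulz_gcdr -ep -eq.
Qed.

Section Couples.
Variables (E : {fset 'X_{1..2}}) (hE : staircase E).
Local Notation i0 := (ord0 : 'I_2).
Local Notation i1 := (ord_max : 'I_2).

(** The significant couples with m to the lower right, respectively to the upper
    left, of c. *)
Definition row_significant (c m : 'X_{1..2}) : Prop :=
  row_couple (line_length E i0 i1) (c i0) (c i1) (m i0) (m i1).
Definition column_significant (c m : 'X_{1..2}) : Prop :=
  row_couple (line_length E i1 i0) (c i1) (c i0) (m i1) (m i0).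

Let i01 : i0 != i1. Proof. by []. Qed.
Let i10 : i1 != i0. Proof. by []. Qed.

(** A couple with positive half-direction has m to the lower right of c. If the
    half-direction is negative, then m is to the left of c, and significance
    forces it not to be below c. *)
Lemma significantP c m :
  significant E (c, m) <-> row_significant c m \/ column_significant c m.
Proof.
split=> [[[clc mE] [d [t t0 [/= e1 e2]] pn]]|].
  (* c does not divide m, because m is in E and c is not. *)
  have nle : (c i0 <= m i0)%N -> (c i1 <= m i1)%N -> False.
    move=> h0 h1; case: clc => /negP cE _; apply: cE.
    by apply: staircase_le hE _ mE; rewrite (lemE i01) h0.
  move: e1 e2; rewrite /expx /expy => e1 e2.
  case: pn => [[[_ hd] s]|[[_ hd] s]].
    left; apply/(significant_for_row hE i01) => //.
    rewrite ltnNge; apply/negP => h1; apply: (nle) => //.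
    by case: hd => [|[]]; nia.
  right; apply/(significant_for_row hE i10) => //.
  rewrite ltnNge; apply/negP => h1; apply: (nle) => //.
  by case: hd => [|[]]; nia.
case=> rc.
  have [clc mE] := row_couple_cleft hE i01 rc; split=> //.
  have [_ _ h0 h1 _] := rc.
  have [|t [d [t0 cp e1 e2]]] := @half_direction_ex
    ((m i0)%:Z - (c i0)%:Z) ((m i1)%:Z - (c i1)%:Z).
    by lia.
  exists d; first by exists t.
  left; split; last exact/(significant_for_row hE i01).
  by split=> //; nia.
have [clc mE] := row_couple_cleft hE i10 rc; split=> //.
have [_ _ h0 h1 _] := rc.
have [|t [d [t0 cp e1 e2]]] := @half_direction_ex
    ((m i0)%:Z - (c i0)%:Z) ((m i1)%:Z - (c i1)%:Z).
  by lia.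
exists d; first by exists t.
right; split; last exact/(significant_for_row hE i10).
by split=> //; nia.
Qed.

(** The list of all significant couples; the clefts are looked for in the rectangle
    containing E. *)
Definition couples : seq (significant_couple E) :=
  undup (pmap (insub : _ -> option {cm | `[< significant E cm >]})
    [seq (mon i0 xy.1 xy.2, m) | xy <- [seq (x, y) |
        x <- iota 0 (line_length E i0 i1 0).+1,
        y <- iota 0 (line_length E i1 i0 0).+1], m <- E]).

Lemma mem_couples (s : significant_couple E) : s \in couples.
Proof.
rewrite mem_undup mem_pmap_sub; case: s => -[c m] hs.
have /asboolP[[clc mE] _] := hs; rewrite -[val _]/(c, m).
have [c0 c1] := (cleft_lineP hE i01 c).1 clc.
apply/allpairsP; exists ((c i0, c i1), m); split=> //; last by rewrite (mon_eta i01).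
apply/allpairsP; exists (c i0, c i1); split=> //; rewrite mem_iota leq0n add0n ltnS.
  by rewrite {1}c0; apply: line_anti.
by rewrite c1; apply: line_anti.
Qed.

Section Homs.
Variable V : zmodType.
Implicit Type a : 'X_{1..2} -> 'X_{1..2} -> V.

Lemma hom_coefsD a a' :
  hom_coefs E a -> hom_coefs E a' -> hom_coefs E (fun u m => a u m + a' u m).
Proof.
by move=> ha ha' u i m uE mE; rewrite ha // ha' //; case: ifP; rewrite ?addr0.
Qed.

Lemma hom_coefsB a a' :
  hom_coefs E a -> hom_coefs E a' -> hom_coefs E (fun u m => a u m - a' u m).
Proof.
by move=> ha ha' u i m uE mE; rewrite ha // ha' //; case: ifP; rewrite ?subr0.
Qed.

(** A homomorphism is determined by its coefficients at the significant couples. *)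
Lemma hom_coefs_eq a a' : hom_coefs E a -> hom_coefs E a' ->
    (forall c m, significant E (c, m) -> a c m = a' c m) ->
  forall u m, u \notin E -> m \in E -> a u m = a' u m.
Proof.
move=> ha ha' e u m uE mE; apply/eqP; rewrite -subr_eq0; apply/eqP.
have hB := hom_coefsB ha ha'.
have [lt1|le1] := ltnP (m i1) (u i1).
  apply: (hom_coefs_row_vanish hE i01 hB) => // c m' rc.
  by rewrite e ?subrr //; apply/significantP; left.
(* An arrow not pointing downwards points to the left, since u does not divide
   m. *)
have lt0 : (m i0 < u i0)%N.
  rewrite ltnNge; apply: contra uE => le0.
  by apply: staircase_le hE _ mE; rewrite (lemE i01) le0.
apply: (hom_coefs_row_vanish hE i10 hB) => // c m' rc.
by rewrite e ?subrr //; apply/significantP; right.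
Qed.

(** The coefficients at the significant couples can be prescribed. *)
Lemma hom_coefs_ex (b : 'X_{1..2} -> 'X_{1..2} -> V) :
  exists2 a, hom_coefs E a & forall c m, significant E (c, m) -> a c m = b c m.
Proof.
exists (fun u m => row_hom E i0 i1 b u m + row_hom E i1 i0 b u m).
  by apply: hom_coefsD; apply: row_hom_coefs.
move=> c m /significantP[rc|rc].
  by case: (rc) => _ _ _ h _; rewrite row_hom_couple // row_hom_left // addr0.
by case: (rc) => _ _ _ h _; rewrite row_hom_left // add0r row_hom_couple.
Qed.

End Homs.
End Couples.

(** * Coordinates on the tangent space *)

Lemma coeff_sum_freegU (R : nzRingType) (K : choiceType) (s : seq K) (F : K -> R) x :
  uniq s -> x \in s -> coeff x (\sum_(y <- s) << F y *g y >>) = F x.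
Proof.
move=> us xs; rewrite raddf_sum /= (bigD1_seq x) //= coeffU eqxx mulr1.
by rewrite big1 ?addr0 // => y /negbTE ne; rewrite coeffU ne mulr0.
Qed.

Section Tangent.
Variables (k : fieldType) (E : {fset 'X_{1..2}}) (hE : staircase E).
Local Notation I := (monomial_ideal k E).

Lemma tangent_eq (J1 J2 : tangent I) : sval J1 = sval J2 -> J1 = J2.
Proof.
case: J1 J2 => [X1 h1] [X2 h2] /= e; case: X2 / e h2 => h2.
by congr exist; apply: Prop_irrelevance.
Qed.

Lemma tangent_coefs (J : tangent I) :
  {a : 'X_{1..2} -> 'X_{1..2} -> 'rV[k]_1 |
    hom_coefs E a /\ sval J = nf_kernel E (tangent_consts E a)}.
Proof.
case: J => J [hJ bJ] /=; apply: cid.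
by have [a] := hilb_tangent_consts hE hJ bJ; exists a.
Qed.

(** The homomorphism corresponding to a tangent vector. *)
Definition coefs (J : tangent I) := sval (tangent_coefs J).

Lemma coefs_hom J : hom_coefs E (coefs J).
Proof. by rewrite /coefs; case: tangent_coefs => a []. Qed.

Lemma coefsE J : sval J = nf_kernel E (tangent_consts E (coefs J)).
Proof. by rewrite /coefs; case: tangent_coefs => a []. Qed.

(** The tangent vector defined by a homomorphism. *)
Definition tangent_of (a : 'X_{1..2} -> 'X_{1..2} -> 'rV[k]_1) (ha : hom_coefs E a) :
    tangent I :=
  exist _ (nf_kernel E (tangent_consts E a))
    (conj (nf_kernel_hilb (tangent_consts_structure hE ha))
          (base_change_aug_consts hE ha)).

Lemma nf_kernel_tangent_consts_eq n (a a' : 'X_{1..2} -> 'X_{1..2} -> 'rV[k]_n) :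
    (forall u m, u \notin E -> m \in E -> a u m = a' u m) ->
  nf_kernel E (tangent_consts E a) = nf_kernel E (tangent_consts E a').
Proof.
move=> e; apply/seteqP; split=> f Jf m mE; rewrite -[RHS](Jf m mE);
  apply: eq_bigr => u _; congr (_ * _); rewrite /tangent_consts.
all: by case: ifPn => // uE; rewrite e.
Qed.

Lemma hom_coefs_mulmx n n' (M : 'M[k]_(n, n'))
    (a : 'X_{1..2} -> 'X_{1..2} -> 'rV[k]_n) :
  hom_coefs E a -> hom_coefs E (fun u m => a u m *m M).
Proof. by move=> ha u i m uE mE; rewrite ha //; case: ifP; rewrite ?mul0mx. Qed.

Lemma base_change_coefs n (M : 'M[k]_(n, 1)) (a : 'X_{1..2} -> 'X_{1..2} -> 'rV[k]_n)
    (J : tangent I) : hom_coefs E a ->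
  base_change (dual_map M) (nf_kernel E (tangent_consts E a)) = sval J <->
  forall u m, u \notin E -> m \in E -> a u m *m M = coefs J u m.
Proof.
move=> ha; have haM := hom_coefs_mulmx M ha.
rewrite (base_change_tangent_consts (M := M) hE ha haM) // coefsE; split.
  by apply: tangent_consts_inj => //; apply: coefs_hom.
exact: nf_kernel_tangent_consts_eq.
Qed.

(** Addition of tangent vectors is addition of homomorphisms: the pair of
    homomorphisms gives the deformation over k[e_1, e_2]. *)
Lemma tangent_addP (J1 J2 J : tangent I) : tangent_add J1 J2 J <->
  forall u m, u \notin E -> m \in E -> coefs J1 u m + coefs J2 u m = coefs J u m.
Proof.
split=> [[K [hK b1 b2 b]] u m uE mE|e].
  have bK : base_change (@dual_aug k (1 + 1)) K = I.
    by rewrite -(proj2 (svalP J1)) -b1 (base_change_comp (h := @dual_aug k (1 + 1))).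
  have [a ha KE] := hilb_tangent_consts hE hK bK; rewrite {}KE in b1 b2 b.
  rewrite -((base_change_coefs _ J1 ha).1 b1) // -((base_change_coefs _ J2 ha).1 b2) //.
  (* As a linear map of maximal ideals, (e_1, e_2) |-> (e, e) is the sum of the two
     other substitutions. *)
  rewrite -((base_change_coefs _ J ha).1 b) // -mulmxDr; congr (_ *m _).
  by rewrite add_col_mx addr0 add0r.
pose a u m : 'rV[k]_(1 + 1) := row_mx (coefs J1 u m) (coefs J2 u m).
have ha : hom_coefs E a.
  move=> u i m uE mE; rewrite /a !coefs_hom //.
  by case: ifP => // _; rewrite row_mx0.
exists (nf_kernel E (tangent_consts E a)); split.
- exact: nf_kernel_hilb (tangent_consts_structure hE ha).
- apply/(base_change_coefs _ _ ha) => u m _ _.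
  by rewrite mul_row_col mulmx1 mulmx0 addr0.
- apply/(base_change_coefs _ _ ha) => u m _ _.
  by rewrite mul_row_col mulmx1 mulmx0 add0r.
- apply/(base_change_coefs _ _ ha) => u m uE mE.
  by rewrite mul_row_col !mulmx1 e.
Qed.

Lemma tangent_scaleP c (J J' : tangent I) : tangent_scale c J J' <->
  forall u m, u \notin E -> m \in E -> c *: coefs J u m = coefs J' u m.
Proof.
rewrite /tangent_scale (coefsE J) base_change_coefs; last exact: coefs_hom.
by split=> h u m uE mE; have := h u m uE mE; rewrite mul_mx_scalar.
Qed.

(** The isomorphism: the coordinate on a couple (c, m) is the coefficient of x^m in
    the image of x^c. *)
Definition significant_coords (J : tangent I) : significant_space k E :=
  \sum_(s <- couples E) << coefs J (val s).1 (val s).2 0 0 *g s >>.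

Lemma coeff_significant_coords J (s : significant_couple E) :
  coeff s (significant_coords J) = coefs J (val s).1 (val s).2 0 0.
Proof. by rewrite coeff_sum_freegU ?undup_uniq ?mem_couples. Qed.

Lemma rV1_eq (v w : 'rV[k]_1) : v 0 0 = w 0 0 -> v = w.
Proof. by move=> e; apply/rowP => i; rewrite !ord1. Qed.

(** The vector of coefficients at the significant couples of a homomorphism a
    corresponds to J exactly if a is the homomorphism of J. *)
Lemma significant_coordsP (a : 'X_{1..2} -> 'X_{1..2} -> 'rV[k]_1)
    (v : significant_space k E) J :
    hom_coefs E a ->
    (forall s : significant_couple E, coeff s v = a (val s).1 (val s).2 0 0) ->
  v = significant_coords J <->
  forall u m, u \notin E -> m \in E -> a u m = coefs J u m.
Proof.
move=> ha va; split=> [e|e].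
  apply: (hom_coefs_eq hE) => //; first exact: coefs_hom.
  move=> c m sg; apply: rV1_eq.
  have h : `[< significant E (c, m) >] by apply/asboolP.
  have := va (exist _ (c, m) h); rewrite e coeff_significant_coords /=.
  by move=> ->.
apply/eqP/freeg_eqP => s; rewrite va coeff_significant_coords.
case: s => -[c m] /= /asboolP [[[cE _] mE] _].
by rewrite e.
Qed.

Lemma significant_coords_bij : bijective significant_coords.
Proof.
have inj : injective significant_coords.
  move=> J1 J2 e; apply: tangent_eq; rewrite !coefsE.
  apply: nf_kernel_tangent_consts_eq.
  apply/(significant_coordsP J2 (coefs_hom J1)); last exact: e.
  exact: coeff_significant_coords.
have /choice[psi psiK] : forall v, exists J, significant_coords J = v.
  move=> v.
  pose b c m : 'rV[k]_1 := if pselect (significant E (c, m)) is left h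
    then const_mx
      (coeff (exist _ (c, m) (introT (asboolP _) h) : significant_couple E) v)
    else 0.
  have [a ha ab] := hom_coefs_ex hE b.
  exists (tangent_of ha); apply/esym/(significant_coordsP (a := a)) => //.
    case=> -[c m] h; rewrite /= ab; last exact/asboolP.
    rewrite /b; case: pselect => [h'|[]]; last exact/asboolP.
    by rewrite mxE; congr (coeff _ v); apply: val_inj.
  apply: tangent_consts_inj => //; first exact: coefs_hom.
  by rewrite -coefsE.
by exists psi => // J; apply: inj.
Qed.

Lemma significant_coords_iso : tangent_iso significant_coords.
Proof.
split; first exact: significant_coords_bij.
- move=> J1 J2 J; rewrite tangent_addP.
  apply: iff_sym; apply: significant_coordsP.
    by apply: hom_coefsD; apply: coefs_hom.
  by move=> s; rewrite coeffD !coeff_significant_coords mxE.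
- move=> c J J'; rewrite tangent_scaleP.
  apply: iff_sym; apply: significant_coordsP.
    move=> u i m uE mE; rewrite coefs_hom //.
    by case: ifP; rewrite ?scaler0.
  by move=> s; rewrite coeffZ coeff_significant_coords mxE.
Qed.

End Tangent.

Theorem theorem8 (k : closedFieldType) (E : {fset 'X_{1..2}}) (hE : staircase E) :
  exists phi : tangent (monomial_ideal k E) -> significant_space k E,
    tangent_iso phi.
Proof. by exists (significant_coords hE); exact: significant_coords_iso. Qed.
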